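(* Let $S_0, S_1 : [\mathbb{N}]^{\mathbb{N}} \to [\mathbb{N}]^{\mathbb{N}}$ be the maps defined, for $n_0 < n_1 < n_2 < \cdots$, by \[S_0(\{n_0, n_1, n_2, \dots\}) = \{n_1, n_2, n_3, \dots\}, \qquad S_1(\{n_0, n_1, n_2, \dots\}) = \{n_1, n_3, n_5, \dots\}.\] Let $G$ be the graph on $[\mathbb{N}]^{\mathbb{N}}$ determined by $S_0$ and $S_1$, and let $E$ be the connected component equivalence relation of $G$. Then $E$ is not hypersmooth.
   Context: $[\mathbb{N}]^{\mathbb{N}}$ is the set of infinite subsets of $\mathbb{N}$, with the Polish topology inherited from $2^{\mathbb{N}}$ via characteristic functions; its elements are identified with their increasing enumerations. The graph $G$ determined by $S_0, S_1$ is the undirected graph on $[\mathbb{N}]^{\mathbb{N}}$ in which $x$ and $x'$ are adjacent iff $x' = S_i(x)$ or $x = S_i(x')$ for some $i \in \{0,1\}$. The connected component equivalence relation $E$ relates $x$ and $y$ iff there is a finite path in $G$ from $x$ to $y$; that is, $E$ is the smallest equivalence relation with $x \mathrel{E} S_i(x)$ for all $x$ and $i \in \{0,1\}$. An equivalence relation $F$ on a standard Borel space $X$ is Borel reducible to an equivalence relation $F'$ on a standard Borel space $Y$ if there is a Borel map $\varphi : X \to Y$ with $a \mathrel{F} b \iff \varphi(a) \mathrel{F'} \varphi(b)$ for all $a,b \in X$. A Borel equivalence relation is smooth if it is Borel reducible to equality on $2^{\mathbb{N}}$. An equivalence relation is hypersmooth if it is the union of an increasing sequence $F_0 \subseteq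 F_1 \subseteq \cdots$ of smooth Borel equivalence relations; equivalently, if it is Borel reducible to the equivalence relation $E_1$ on $(2^{\mathbb{N}})^{\mathbb{N}}$ given by $(a_n)_n \mathrel{E_1} (b_n)_n \iff \exists m\ \forall n \geq m\ (a_n = b_n)$. *)

(* Defs.v *)
From HB Require Import structures.
From mathcomp Require Import all_boot all_order all_algebra.
From mathcomp Require Import all_classical all_reals all_analysis.

Set Implicit Arguments.
Unset Strict Implicit.
Unset Printing Implicit Defensive.

Local Open Scope classical_set_scope.
Local Open Scope nat_scope.

(* A topological space equipped with its Borel sigma-algebra. *)
Notation borel T := (g_sigma_algebraType (@open T)).

Section borel_equivalence_relations.
Context d (X : measurableType d).

Definition borel_reducible d' (Y : measurableType d')
    (F : X -> X -> Prop) (F' : Y -> Y -> Prop) : Prop :=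
  exists2 phi : X -> Y, measurable_fun setT phi &
    forall a b, F a b <-> F' (phi a) (phi b).

Definition borel_equivalence (F : X -> X -> Prop) : Prop :=
  RelationClasses.Equivalence F /\ measurable [set p : X * X | F p.1 p.2].

Definition smooth (F : X -> X -> Prop) : Prop :=
  borel_equivalence F /\
  borel_reducible F (fun u v : borel cantor_space => u = v).

Definition hypersmooth (E : X -> X -> Prop) : Prop :=
  exists F : nat -> X -> X -> Prop,
    [/\ forall n, smooth (F n),
        forall n x y, F n x y -> F n.+1 x y &
        forall x y, E x y <-> exists n, F n x y].

End borel_equivalence_relations.

(* [N]^N, as a subtype of 2^N: [set_type] carries the initial topology of the
   inclusion, i.e. the subspace topology. *)
Definition infinite_subsets : set cantor_space :=
  [set x | infinite_set [set n | x n]].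

Definition infN : Type := set_type infinite_subsets.

HB.instance Definition _ := Topological.on infN.

Implicit Types (x y : infN) (f : nat -> nat).

Definition elts x : set nat := [set n | (\val x : cantor_space) n].

Lemma elts_inj : injective elts.
Proof.
move=> x y exy; apply/val_inj/funext => n; apply/idP/idP => xn.
- by have : elts x n by []; rewrite exy.
- by have : elts y n by []; rewrite -exy.
Qed.

Lemma elts_above x n : exists m, (n <= m) && (\val x : cantor_space) m.
Proof.
have /set_mem xinf := valP x; apply: contrapT => nx; apply: xinf.
apply: (@sub_finite_set _ _ `I_n); last exact: finite_II.
move=> m xm /=; rewrite ltnNge; apply/negP => nm.
by apply: nx; exists m; rewrite nm.
Qed.

(* The increasing enumeration n_0 < n_1 < n_2 < ... of x. *)
Fixpoint enumeration x (k : nat) : nat :=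
  if k is k'.+1 then ex_minn (elts_above x (enumeration x k').+1)
  else ex_minn (elts_above x 0).

Lemma enumeration_lt x : {homo enumeration x : i j / i < j}.
Proof.
by apply: homo_ltn => [? ? ?|k /=]; [exact: ltn_trans|case: ex_minnP => m /andP[? ?] _].
Qed.

Lemma enumeration_elts x k : elts x (enumeration x k).
Proof. by case: k => [|k] /=; case: ex_minnP => m; [|case/andP]. Qed.

Lemma ge_id_homo f : {homo f : i j / i < j} -> forall k, k <= f k.
Proof. by move=> fi; elim=> // k IH; apply: (leq_ltn_trans IH); exact: fi. Qed.

Lemma range_infinite f : {homo f : i j / i < j} ->
  (fun n => `[< range f n >]) \in infinite_subsets.
Proof.
move=> fi; apply/mem_set => fin; apply: infinite_nat.
have fI : {in f @^-1` [set n | `[< range f n >]] &, injective f}.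
  by move=> i j _ _ fij; case: (ltngtP i j) => // /fi; rewrite fij ltnn.
apply: sub_finite_set (finite_preimage fI fin) => k _ /=.
by apply/asboolP; exists k.
Qed.

(* The infinite set {f 0 < f 1 < f 2 < ...}. *)
Definition of_enumeration f (fi : {homo f : i j / i < j}) : infN :=
  exist _ (fun n => `[< range f n >]) (range_infinite fi).

Lemma enumeration_succ x : {homo (fun k => enumeration x k.+1) : i j / i < j}.
Proof. by move=> i j ij; exact: enumeration_lt. Qed.

Lemma enumeration_odd x :
  {homo (fun k => enumeration x k.*2.+1) : i j / i < j}.
Proof. by move=> i j ij; apply: enumeration_lt; rewrite ltnS ltn_double. Qed.

Definition S0 x : infN := of_enumeration (enumeration_succ x).
Definition S1 x : infN := of_enumeration (enumeration_odd x).

Lemma elts_of_enumeration f (fi : {homo f : i j / i < j}) :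
  elts (of_enumeration fi) = range f.
Proof. by apply/seteqP; split => n /= /asboolP. Qed.

Lemma range_enumeration x : range (enumeration x) = elts x.
Proof.
apply/seteqP; split => [_ [k _ <-]|n xn]; first exact: enumeration_elts.
have [k kn nk] : exists2 k, enumeration x k <= n & n < enumeration x k.+1.
  have : exists m, n < enumeration x m.+1.
    by exists n; exact: (ge_id_homo (@enumeration_lt x)).
  case; elim=> [|k IH] nk.
    by exists 0 => //=; case: ex_minnP => m _; exact.
  by have [/IH//|kn] := ltnP n (enumeration x k.+1); exists k.+1.
exists k => //; apply/eqP; rewrite eqn_leq kn /=; rewrite leqNgt; apply/negP => kn'.
move: nk => /=; case: ex_minnP => m _ /(_ n); rewrite kn' => /(_ xn).
by rewrite ltnNge => ->.
Qed.

Lemma homo_range_inj f g : {homo f : i j / i < j} -> {homo g : i j / i < j} ->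
  range f = range g -> f =1 g.
Proof.
have ltP h : {homo h : i j / i < j} -> {mono h : i j / i < j}.
  by move=> hi; apply: leqW_mono; apply: leq_mono.
move=> fi gi fg; elim/ltn_ind => k IH.
have half (h h' : nat -> nat) : {homo h : i j / i < j} ->
    {homo h' : i j / i < j} -> range h = range h' ->
    (forall m, m < k -> h m = h' m) -> h' k <= h k.
  move=> hi h'i hh' IHh; have : range h' (h k) by rewrite -hh'; exists k.
  move=> [j _ jk]; rewrite -jk leqNgt; apply/negP; rewrite (ltP _ h'i) => jltk.
  by move: jk; rewrite -IHh// => /eqP; rewrite ltn_eqF // hi.
by apply/eqP; rewrite eqn_leq !half// => m mk; rewrite IH.
Qed.

Lemma enumerationK f (fi : {homo f : i j / i < j}) :
  enumeration (of_enumeration fi) =1 f.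
Proof.
apply: homo_range_inj => //; first exact: enumeration_lt.
by rewrite range_enumeration elts_of_enumeration.
Qed.

Lemma S0_of_enumeration f (fi : {homo f : i j / i < j}) :
  elts (S0 (of_enumeration fi)) = [set f k.+1 | k in setT].
Proof.
rewrite elts_of_enumeration; congr image.
by apply/funext => k; rewrite enumerationK.
Qed.

Lemma S1_of_enumeration f (fi : {homo f : i j / i < j}) :
  elts (S1 (of_enumeration fi)) = [set f k.*2.+1 | k in setT].
Proof.
rewrite elts_of_enumeration; congr image.
by apply/funext => k; rewrite enumerationK.
Qed.

(* The unpointed [set_type] needs a base point to be a [measurableType]. *)
HB.instance Definition _ := isPointed.Build infN (@of_enumeration id (fun i j => id)).

Definition adjacent x y : Prop :=
  (y = S0 x \/ x = S0 y) \/ (y = S1 x \/ x = S1 y).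

(* [path] expects a boolean relation, hence the reflection. *)
Definition component x y : Prop :=
  exists2 p : seq infN, path (fun u v => `[< adjacent u v >]) x p & y = last x p.

Lemma component_equivalence : RelationClasses.Equivalence component.
Proof.
have symA u v : adjacent u v -> adjacent v u by move=> [[]|[]]; rewrite /adjacent; tauto.
have trans x y z : component x y -> component y z -> component x z.
  move=> [p xp ->] [q yq ->]; exists (p ++ q); last by rewrite last_cat.
  by rewrite cat_path xp.
split=> //; first by move=> x; exists [::].
move=> x _ [p + ->]; elim: p x => [|z p IH] x /=; first by exists [::].
move=> /andP[/asboolP xz /IH]; move=> /trans; apply.
by exists [:: x] => //=; rewrite andbT; apply/asboolP/symA.
Qed.

Lemma component_smallest (R : infN -> infN -> Prop) :
  RelationClasses.Equivalence R ->
  (forall x, R x (S0 x)) -> (forall x, R x (S1 x)) ->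
  forall x y, component x y -> R x y.
Proof.
move=> [Rr Rs Rt] R0 R1 x _ [p + ->]; elim: p x => [|z p IH] x /=; first by [].
move=> /andP[/asboolP xz /IH]; apply: Rt.
by case: xz => [[]|[]] ->; [|apply: Rs| |apply: Rs].
Qed.

(* Main.v *)
Require Import Defs.
From mathcomp Require Import all_boot all_order all_algebra.
From mathcomp Require Import all_classical all_reals all_analysis.
From mathcomp Require Import zify.

Set Implicit Arguments.
Unset Strict Implicit.
Unset Printing Implicit Defensive.

Local Open Scope classical_set_scope.
Local Open Scope nat_scope.

(** Suppose [component] is the increasing union of smooth relations [F n], and
    let the cost of [x] be the least [n] such that [x], [S0 x] and [S1 x] are
    [F n]-equivalent. The sets of points of cost at most [n] are Borel, hence
    Ramsey, so on the infinite subsets of a suitable [A] the cost is a continuous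
    function: every [x] has a finite initial segment that decides it. The tree of
    undecided initial segments is then well-founded and has a rank
    ([ramsey_ranked]).

    The heart of the proof ([descent]) is an induction on this rank. If it is not
    zero, take [p < q < r] in [A] and replace each relation [R n] by its
    translate: [x] and [y] are related when [R n] relates the sets [x] and [y]
    with [q] added. The translated relations again absorb [S0] and [S1], at a
    cost of smaller rank. Indeed [S0] and [S1] applied to [p, q, r, x] and to its
    shortenings show that [q] followed by the even-indexed elements of [x] is
    equivalent to [r] followed by its odd-indexed elements
    ([link_interleave]). Since the odd elements can be kept while the even ones
    move inside their gaps, and conversely, four such equivalences lead from [c]
    to [S0 c], with [q] in front ([links_of_stem_links]). The costs involved are
    costs of sets beginning with two of [p, q, r], hence have rank lower by at
    least two (or zero); moving to [S0 c] delays reading by one element, so one unit of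
    rank may be lost, and at least one is gained. A shift alone would not allow
    this: it generates a hypersmooth relation. Choosing the fillings freely
    relies on [S1] being far from injective.

    At rank zero there are a finite stem [s] and a single [N] such that [F N]
    relates [s] followed by [x] to [s] followed by [S0 x], for all infinite
    subsets [x] of some [B]. A Borel reduction of [F N] to equality does not
    notice when elements after [s] are dropped from the front, so by the Ramsey
    property it is constant on the sets [s] followed by [x], for [x] in some
    smaller cube ([ramsey_tail_constant]). Hence all infinite subsets of some set
    lie in one component. This is absurd, as enumerations of sets in one component
    dominate each other up to a linear change of index ([component_growth]). *)

(** * The Ramsey property *)

Lemma infinite_nat_setP (A : set nat) :
  infinite_set A <-> forall n, exists2 m, n <= m & A m.
Proof.
split=> [Ainf n|AP Afin].
  apply: contrapT => nA; apply: Ainf; apply: sub_finite_set (finite_II n) => m Am /=.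
  by rewrite ltnNge; apply/negP => nm; apply: nA; exists m.
have /finite_fsetP[X AX] := Afin.
have [m + Am] := AP (\max_(i <- finmap.enum_fset X) i).+1.
have mX : m \in finmap.enum_fset X by move: Am; rewrite AX.
by rewrite ltnNge (@leq_bigmax_seq _ _ xpredT id).
Qed.

Lemma infinite_setDI (A : set nat) n : infinite_set A -> infinite_set (A `\` `I_n).
Proof. by move=> Ai; apply: infinite_setD => //; exact: finite_II. Qed.

Lemma infinite_range (f : nat -> nat) :
  {homo f : i j / i < j} -> infinite_set (range f).
Proof.
move=> fi; apply/infinite_nat_setP => n; exists (f n); last by exists n.
exact: ge_id_homo.
Qed.

(** If, below every infinite set, some [b] satisfies [Q b] on a further infinite
    set, then the successive choices can be arranged in one decreasing sequence,
    whose diagonal satisfies [Q b] above each of its elements [b]. *)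
Lemma fusion (Q : nat -> set nat -> Prop) (A : set nat) :
  infinite_set A ->
  (forall b B C, C `<=` B -> Q b B -> Q b C) ->
  (forall B, B `<=` A -> infinite_set B ->
    exists b C, [/\ B b, C `<=` B, infinite_set C & Q b C]) ->
  exists B, [/\ B `<=` A, infinite_set B & forall b, B b -> Q b (B `\` `I_b.+1)].
Proof.
move=> Ai Qh Qd.
have /choice[nx nxP] : forall B, exists p : nat * set nat, B `<=` A ->
    infinite_set B ->
    [/\ B p.1, p.2 `<=` B `\` `I_p.1.+1, infinite_set p.2 & Q p.1 p.2].
  move=> B; have [BA|] := pselect (B `<=` A); last by exists (0, set0).
  have [Bi|] := pselect (infinite_set B); last by exists (0, set0).
  have [b [C [Bb CB Ci QC]]] := Qd _ BA Bi.
  exists (b, C `\` `I_b.+1) => _ _; split=> //=.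
  - by apply: setSD.
  - exact: infinite_setDI.
  - by apply: Qh QC; exact: subDsetl.
pose W k := iter k (fun B => (nx B).2) A.
pose f k := (nx (W k)).1.
have WP k : W k `<=` A /\ infinite_set (W k).
  elim: k => [|k [WA Wi]]; first by split.
  have [_ h1 h2 _] := nxP _ WA Wi.
  by split=> // x /h1[Wx _]; exact: WA.
have stepP k : [/\ W k (f k), W k.+1 `<=` W k `\` `I_(f k).+1 & Q (f k) (W k.+1)].
  by have [WA Wi] := WP k; have [] := nxP _ WA Wi.
have Wsub i j : i <= j -> W j `<=` W i.
  move=> ij; rewrite -(subnK ij); elim: (j - i) => [//|n IH] x.
  by have [_ h _] := stepP (n + i); rewrite addSn => /h[/IH].
have fi : {homo f : i j / i < j}.
  move=> i j ij; have [Wj _ _] := stepP j; have [_ h _] := stepP i.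
  by have [_ /=] := h _ (Wsub _ _ ij _ Wj); lia.
exists (range f); split.
- by move=> _ [k _ <-]; have [Wk _ _] := stepP k; have [WA _] := WP k; exact: WA.
- exact: infinite_range.
- move=> _ [k _ <-]; have [_ _ Qk] := stepP k; apply: Qh Qk.
  move=> _ [[j _ <-] /= fkj]; have [Wj _ _] := stepP j; apply: (Wsub k.+1 j _ _ Wj).
  by case: (ltngtP j k) fkj => // [/fi|->]; lia.
Qed.

(** Lets [fusion] treat all the finitely many sets below its current element at
    one stage. *)
Lemma dense_initial (P : set nat -> set nat -> Prop) n A :
  infinite_set A ->
  (forall t B C, C `<=` B -> P t B -> P t C) ->
  (forall t B, finite_set t -> B `<=` A -> infinite_set B ->
    exists C, [/\ C `<=` B, infinite_set C & P t C]) ->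
  exists B, [/\ B `<=` A, infinite_set B & forall t, t `<=` `I_n -> P t B].
Proof.
move=> Ai; elim: n P => [|n IH] P Ph Pd.
  have [C [CA Ci PC]] := Pd set0 A (@finite_set0 _) (@subset_refl _ A) Ai.
  by exists C; split=> // t t0; rewrite (_ : t = set0)//; apply/seteqP; split=> // x /t0.
have [|t B tf BA Bi|B [BA Bi PB]] := IH (fun t B => P t B /\ P (n |` t) B).
- by move=> t B C CB [h1 h2]; split; apply: Ph CB _.
- have [C [CB Ci PC]] := Pd t B tf BA Bi.
  have [||D [DC Di PD]] := Pd (n |` t) C _ _ Ci.
  + by rewrite finite_setU; split=> //; exact: finite_set1.
  + exact: subset_trans BA.
  by exists D; split=> //; [exact: subset_trans CB|split=> //; exact: Ph PC].
exists B; split=> // t tn; have [|h1 h2] := PB (t `&` `I_n) _; first exact: subIsetr.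
have [tn'|tn'] := pselect (t n).
  suff -> : t = n |` (t `&` `I_n) by [].
  apply/seteqP; split=> [x tx|x [->//|[]//]].
  by have := tn _ tx; rewrite /= ltnS leq_eqVlt => /orP[/eqP->|?]; [left|right].
suff -> : t = t `&` `I_n by [].
apply/seteqP; split=> [x tx|x []//]; split=> //.
by have := tn _ tx; rewrite /= ltnS leq_eqVlt => /orP[/eqP xn|//]; subst x.
Qed.

Definition cube (s A : set nat) : set (set nat) :=
  [set x | [/\ infinite_set x, s `<=` x & x `<=` s `|` A]].

Lemma cubeS s A B : A `<=` B -> cube s A `<=` cube s B.
Proof. by move=> AB x [xi sx xA]; split=> //; apply: subset_trans xA _; exact: setUS. Qed.

Lemma cube_initial s A x n :
  cube s A x -> cube (s `|` (x `&` `I_n)) (A `\` `I_n) x.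
Proof.
move=> [xi sx xA]; split=> //; first by move=> y [/sx|[]].
move=> y xy; have [yn|ny] := ltnP y n; first by left; right.
by have [ys|yA] := xA y xy; [left; left|right; split=> //=; lia].
Qed.

Definition decided (U : set (set nat)) s A := cube s A `<=` U \/ cube s A `<=` ~` U.

Lemma decidedS U s A B : A `<=` B -> decided U s B -> decided U s A.
Proof. by move=> /(@cubeS s) AB [] h; [left|right]; exact: subset_trans h. Qed.

(** Nash-Williams: sets that are relatively open in a cube are decided on a
    smaller one. A cube accepts a finite [t] when adding [t] to its stem puts it
    inside [U], and rejects [t] when no smaller cube accepts it. On a suitable
    [B], if the empty set is rejected then by induction all finite subsets are,
    and openness forbids any point of the cube to be in [U]. *)
Lemma decide_open U s A : finite_set s -> infinite_set A ->
  (forall x, U x -> cube s A x ->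
    exists n, cube (s `|` (x `&` `I_n)) (A `\` `I_n) `<=` U) ->
  exists B, [/\ B `<=` A, infinite_set B & decided U s B].
Proof.
move=> sf Ai Uo; pose accept t B := cube (s `|` t) B `<=` U.
pose reject t B := forall C, C `<=` B -> infinite_set C -> ~ accept t C.
pose D t B := accept t B \/ reject t B /\ forall n, B n -> reject (n |` t) B.
have acceptS t B C : C `<=` B -> accept t B -> accept t C.
  by move=> CB; apply: subset_trans; exact: cubeS.
have rejectS t B C : C `<=` B -> reject t B -> reject t C.
  by move=> CB h E EC; apply: h; exact: subset_trans CB.
have DS t B C : C `<=` B -> D t B -> D t C.
  move=> CB [/(acceptS _ _ _ CB)|[/(rejectS _ _ _ CB) h1 h2]]; first by left.
  by right; split=> // n /CB/h2; exact: rejectS.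
have Dd t B : finite_set t -> B `<=` A -> infinite_set B ->
    exists C, [/\ C `<=` B, infinite_set C & D t C].
  move=> tf BA Bi.
  have [[C [CB Ci aC]]|na] := pselect (exists C, [/\ C `<=` B, infinite_set C & accept t C]).
    by exists C; split=> //; left.
  have rB : reject t B by move=> C CB Ci aC; apply: na; exists C.
  apply: contrapT => nD.
  have [n C D' D'C|C CB Ci|C [CB Ci aC]] := @fusion (fun n C => accept (n |` t) C) B Bi.
  - exact: acceptS.
  - apply: contrapT => nC; apply: nD; exists C; split=> //; right.
    split; first exact: rejectS rB.
    by move=> n Cn E EC Ei aE; apply: nC; exists n, E.
  (* The first element of [x] outside the stem selects the cube containing [x]. *)
  apply: (rB C CB Ci) => x [xi stx xC].
  have /infinite_setN0 : infinite_set (x `\` (s `|` t)).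
    by apply: infinite_setD; rewrite // finite_setU.
  move=> [m0 xm0]; have [m [xm mst] mP] : exists2 m, (x `\` (s `|` t)) m &
      forall y, (x `\` (s `|` t)) y -> m <= y.
    have ex : exists m, `[< (x `\` (s `|` t)) m >] by exists m0; apply/asboolP.
    case: (ex_minnP ex) => m /asboolP xm mP; exists m => // y xy.
    by apply: mP; apply/asboolP.
  have Cm : C m by have [] := xC _ xm.
  apply: (aC m Cm); split=> // [y [sy|[->//|ty]]|y xy]; [exact/stx/or_introl|exact/stx/or_intror|].
  have [st|nst] := pselect ((s `|` t) y); first by case: st; [left; left|left; right; right].
  have := mP y (conj xy nst); rewrite leq_eqVlt => /orP[/eqP<-|my]; first by left; right; left.
  by right; split; [case: (xC y xy)|rewrite /=; lia].
have [C0 [C0A C0i DC0]] := Dd set0 A (@finite_set0 _) (@subset_refl _ A) Ai.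
have [|B' B'C0 B'i|B [BC0 Bi DB]] := @fusion (fun b C => forall t, t `<=` `I_b.+1 -> D t C) C0 C0i.
- by move=> b B C CB h t /h; exact: DS.
- have [b Bb] := infinite_setN0 B'i.
  have [|||C [CB Ci PC]] := @dense_initial D b.+1 B' => //.
    move=> t C tf CB; apply: Dd => //; apply: subset_trans CB _.
    exact: subset_trans C0A.
  by exists b, C.
have BA := subset_trans BC0 C0A.
exists B; split=> //.
have [a0|[r0 _]] := DS _ _ _ BC0 DC0.
  by left; move: a0; rewrite /accept setU0.
have I0 : B `\` `I_0 = B by apply/seteqP; split=> [x []//|x Bx]; split.
right.
have rP n : forall t, t `<=` B `&` `I_n -> D t (B `\` `I_n) /\ reject t (B `\` `I_n).
  elim: n => [t|n IH t tB].
    rewrite I0 => t0; rewrite (_ : t = set0); last by apply/seteqP; split=> // x /t0[].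
    by split=> //; exact: DS DC0.
  have subB : B `\` `I_n.+1 `<=` B `\` `I_n by move=> y [By /= yn]; split=> //=; lia.
  have t'B : t `&` `I_n `<=` B `&` `I_n by move=> y [/tB[]].
  have [Dt' rt'] := IH _ t'B.
  have [Bn|nBn] := pselect (B n); last first.
    have tt' : t `&` `I_n = t.
      apply/seteqP; split=> [y []//|y ty]; split=> //; have [By] := tB _ ty.
      by rewrite /= ltnS leq_eqVlt => /orP[/eqP yn|//]; subst y.
    by rewrite tt' in Dt' rt'; split; [exact: DS Dt'|exact: rejectS rt'].
  split; first by apply: DB => // y /tB[].
  have [tn|ntn] := pselect (t n); last first.
    have tt' : t `&` `I_n = t.
      apply/seteqP; split=> [y []//|y ty]; split=> //; have [By] := tB _ ty.
      by rewrite /= ltnS leq_eqVlt => /orP[/eqP yn|//]; subst y.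
    by rewrite tt' in rt'; exact: rejectS rt'.
  have -> : t = n |` (t `&` `I_n).
    apply/seteqP; split=> [y ty|y [->//|[]//]]; have [By] := tB _ ty.
    by rewrite /= ltnS leq_eqVlt => /orP[/eqP->|?]; [left|right].
  have Bni : infinite_set (B `\` `I_n) by exact: infinite_setDI.
  case: Dt' => [/(rt' _ (@subset_refl _ _) Bni)//|[_ h]].
  by apply: (rejectS _ _ _ subB); apply: h; split=> //=; rewrite ltnn.
move=> x xB Ux; have [n aU] := Uo x Ux (cubeS BA xB).
have [|_ r] := rP n (x `&` `I_n `&` B); first by move=> y [[_ yn] By].
have Bni : infinite_set (B `\` `I_n) by exact: infinite_setDI.
apply: (r _ (@subset_refl _ _) Bni) => y [yi sty yB].
case: xB => _ sx xB; apply: aU; split=> // [z [sz|[xz zn]]|z /yB[[sz|[[xz zn] _]]|[Bz zn]]].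
- by apply: sty; left.
- by have [sz|Bz] := xB z xz; apply: sty; [left|right].
- by left; left.
- by left; right.
- by right; split=> //; exact: BA.
Qed.

(** The stem is allowed to be any finite set so that the property passes from [U]
    to its sections, which is what the diagonal arguments need. *)
Definition ramsey (U : set (set nat)) := forall s A, finite_set s ->
  infinite_set A -> exists B, [/\ B `<=` A, infinite_set B & decided U s B].

Lemma ramseyC U : ramsey U -> ramsey (~` U).
Proof.
move=> UR s A sf Ai; have [B [BA Bi [UB|UB]]] := UR s A sf Ai; exists B; split=> //.
  by right; rewrite setCK.
by left.
Qed.

(** Every [U i] becomes relatively clopen: a point [x] of the new cube is decided
    by its elements up to any [b] in [B] with [i <= b]. *)
Lemma ramsey_fusion (U : nat -> set (set nat)) s A :
  (forall i, ramsey (U i)) -> finite_set s -> infinite_set A ->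
  exists B, [/\ B `<=` A, infinite_set B & forall b, B b ->
    forall t i, t `<=` `I_b.+1 -> i <= b -> decided (U i) (s `|` t) (B `\` `I_b.+1)].
Proof.
move=> UR sf Ai.
apply: (@fusion (fun b C => forall t i, t `<=` `I_b.+1 -> i <= b ->
  decided (U i) (s `|` t) C)) => // [b B C CB h t i tb ib|B BA Bi].
  by apply: decidedS CB _; exact: h.
have [b Bb] := infinite_setN0 Bi.
pose P t C := forall i, i < b.+1 -> decided (U i) (s `|` t) C.
have [t C D DC h i ib|t C tf CB Ci|C [CB Ci PC]] := @dense_initial P b.+1 B Bi.
- by apply: decidedS DC _; exact: h.
- rewrite /P; elim: b.+1 => [|k [D [DC Di h]]]; first by exists C; split.
  have [|E [ED Ei dE]] := UR k (s `|` t) D _ Di; first by rewrite finite_setU.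
  exists E; split=> //; first exact: subset_trans DC.
  move=> i; rewrite ltnS leq_eqVlt => /orP[/eqP->//|/h].
  exact: decidedS.
by exists b, C; split=> // t i tb ib; exact: PC.
Qed.

Lemma ramsey_bigcup (U : nat -> set (set nat)) :
  (forall i, ramsey (U i)) -> ramsey (\bigcup_i U i).
Proof.
move=> UR s A sf Ai; have [B [BA Bi h]] := ramsey_fusion UR sf Ai.
have [|C [CB Ci dC]] := @decide_open (\bigcup_i U i) s B sf Bi; last first.
  by exists C; split=> //; exact: subset_trans BA.
move=> x [i _ Ux] xB; have /infinite_nat_setP/(_ i)[b ib Bb] := Bi.
exists b.+1; have xI := @cube_initial _ _ _ b.+1 xB.
have [|dU|dU] := h b Bb (x `&` `I_b.+1) i _ ib; first exact: subIsetr.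
  by apply: subset_trans dU _ => y Uy; exists i.
by have := dU _ xI.
Qed.

(** * Ranks of cost functions *)

(** Well-founded trees stand in for countable ordinals. *)
Inductive tree := Leaf | Node of nat -> tree.

(** Comparison of the ordinal heights. *)
Fixpoint tree_le (t t' : tree) : Prop :=
  match t, t' with
  | Leaf, _ => True
  | Node _, Leaf => False
  | Node f, Node g => forall a, exists b, tree_le (f a) (g b)
  end.

Lemma tree_le_refl t : tree_le t t.
Proof. by elim: t => // f IH a; exists a; exact: IH. Qed.

Lemma tree_le_child f b : tree_le (f b) (Node f).
Proof.
move: {2}(f b) (erefl (f b)) => t; elim: t f b => [|g IH] f b fb; rewrite fb// => a.
by exists b; rewrite fb; exact: IH.
Qed.

Lemma tree_le_total t t' : tree_le t t' \/ tree_le t' t.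
Proof.
elim: t t' => [|f IH] [|g]; [by left|by left|by right|].
have [?|/existsNP[a /forallNP na]] := pselect (tree_le (Node f) (Node g)); first by left.
by right=> b; exists a; have [/na|] := IH a (g b).
Qed.

Lemma tree_le_join f (i j : nat) :
  exists k, tree_le (f i) (f k) /\ tree_le (f j) (f k).
Proof.
have [?|?] := tree_le_total (f i) (f j); [exists j|exists i];
  by split=> //; exact: tree_le_refl.
Qed.

(** Here [P N x] says that [x] has cost at most [N]. The predicate [ranked t P A]
    holds when the elements of a subset of [A] can be read in increasing order so
    that, after at most [t] many of them in the ordinal sense, a bound for the
    cost is known. *)
Fixpoint ranked (t : tree) (P : nat -> set nat -> Prop) (A : set nat) : Prop :=
  match t with
  | Leaf => exists N, forall x, x `<=` A -> infinite_set x -> P N x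
  | Node f => forall a, A a ->
      exists b, ranked (f b) (fun N x => P N (a |` x)) (A `\` `I_a.+1)
  end.

Definition cost_pred (P : nat -> set nat -> Prop) :=
  forall M N x, M <= N -> P M x -> P N x.

Lemma ranked_mono t P Q A B : B `<=` A ->
  (forall N x, x `<=` B -> infinite_set x -> P N x -> Q N x) ->
  ranked t P A -> ranked t Q B.
Proof.
elim: t P Q A B => [|f IH] P Q A B BA PQ /=.
  by move=> [N PN]; exists N => x xB xi; apply: PQ => //; apply: PN => //; exact: subset_trans BA.
move=> h a Ba; have [b hb] := h a (BA _ Ba); exists b; move: hb.
apply: IH; first exact: setSD.
move=> N x xB xi; apply: PQ; first by move=> y [->//|/xB[]].
by apply: sub_infinite_set xi => y; right.
Qed.

Lemma ranked_sub t P A B : B `<=` A -> ranked t P A -> ranked t P B.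
Proof. by move=> BA; apply: ranked_mono. Qed.

Lemma ranked_le t t' P A : tree_le t t' -> ranked t P A -> ranked t' P A.
Proof.
elim: t t' P A => [|f IH] t' P A.
  move=> _ [N PN]; elim: t' P A PN => [|g IH] P A PN; first by exists N.
  move=> a Aa; exists 0; apply: IH => x xA xi; apply: PN.
    by move=> y [->//|/xA[]].
  by apply: sub_infinite_set xi => y; right.
case: t' => [//|g] fg h a Aa; have [b hb] := h a Aa; have [c bc] := fg b.
by exists c; apply: IH hb.
Qed.

(** No rank is lost in a conjunction, because heights of trees are linearly
    ordered: the two branches can be replaced by the taller one. *)
Lemma ranked_and t P Q A : cost_pred P -> cost_pred Q ->
  ranked t P A -> ranked t Q A -> ranked t (fun N x => P N x /\ Q N x) A.
Proof.
elim: t P Q A => [|f IH] P Q A Pm Qm /=.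
  move=> [M PM] [N QN]; exists (maxn M N) => x xA xi.
  by split; [apply: Pm (leq_maxl _ _) _; exact: PM|apply: Qm (leq_maxr _ _) _; exact: QN].
move=> hP hQ a Aa; have [i hi] := hP a Aa; have [j hj] := hQ a Aa.
have [k [ik jk]] := tree_le_join f i j; exists k.
apply: IH; [by move=> M N x; exact: Pm|by move=> M N x; exact: Qm| |].
  exact: ranked_le hi.
exact: ranked_le hj.
Qed.

Lemma ranked_cons t P A a : A a -> ranked t P A ->
  ranked t (fun N x => P N (a |` x)) (A `\` `I_a.+1).
Proof.
move=> Aa; case: t => [|f] h; last first.
  by have [b] := h a Aa; apply: ranked_le; exact: tree_le_child.
have [N PN] := h; exists N => x xA xi; apply: PN; first by move=> y [->//|/xA[]].
by apply: sub_infinite_set xi => y; right.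
Qed.

(** Fixing elements that would be read first can only help. *)
Lemma ranked_stem t P A l B : sorted ltn l -> [set` l] `<=` A -> B `<=` A ->
  (forall y z, y \in l -> B z -> y < z) -> ranked t P A ->
  ranked t (fun N x => P N ([set` l] `|` x)) B.
Proof.
elim: l P A => [|a l IH] P A /= ls lA BA lB h.
  apply: ranked_mono h => // N x _ _; rewrite (_ : _ `|` x = x)//.
  by apply/seteqP; split=> [y []//|y xy]; right.
have Aa : A a by apply: lA; rewrite /= mem_head.
have al y : y \in l -> a < y.
  by move=> yl; move: ls; rewrite (path_sortedE ltn_trans) => /andP[/allP/(_ _ yl)].
have h' : ranked t (fun N x => P N (a |` ([set` l] `|` x))) B.
  apply: (IH (fun N x => P N (a |` x)) (A `\` `I_a.+1) (path_sorted ls)).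
  - by move=> y yl; split; [apply: lA; rewrite /= inE yl orbT|rewrite /=; have := al y yl; lia].
  - move=> y By; split; first exact: BA.
    by have := lB a y (mem_head _ _) By; rewrite /=; lia.
  - by move=> y z yl; apply: lB; rewrite inE yl orbT.
  - exact: ranked_cons.
apply: ranked_mono h' => // N x _ _; congr P; apply/seteqP; split=> y /=.
  by move=> [->|[yl|xy]]; [left; exact: mem_head|left; rewrite inE yl orbT|right].
by rewrite inE => -[/orP[/eqP->|yl]|xy]; [left|right; left|right; right].
Qed.

(** Replacing each element [a] of [x] by a finite block [rho a]. *)
Definition spread (rho : nat -> seq nat) (x : set nat) : set nat :=
  \bigcup_(a in x) [set` rho a].

(** The blocks lie in [A] and stay in the same order as the elements they
    replace. *)
Definition spreading (rho : nat -> seq nat) (A B : set nat) :=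
  [/\ forall a, B a -> sorted ltn (rho a) /\ rho a <> [::],
      forall a, B a -> [set` rho a] `<=` A,
      forall a y, B a -> y \in rho a -> a <= y &
      forall a b y, B a -> B b -> a < b -> y \in rho a -> y < b].

Lemma spreading_sub rho A B C : C `<=` B -> spreading rho A B -> spreading rho A C.
Proof.
move=> CB [h1 h2 h3 h4]; split.
- by move=> a /CB; exact: h1.
- by move=> a /CB; exact: h2.
- by move=> a y /CB; exact: h3.
- by move=> a b y /CB Ba /CB; exact: h4.
Qed.

Lemma spread_sub rho A B x : spreading rho A B -> x `<=` B -> spread rho x `<=` A.
Proof. by move=> [_ h _ _] xB y [a /xB/h]; exact. Qed.

Lemma spread_infinite rho A B x : spreading rho A B -> x `<=` B ->
  infinite_set x -> infinite_set (spread rho x).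
Proof.
move=> [h1 _ h3 _] xB /infinite_nat_setP xi; apply/infinite_nat_setP => n.
have [a na xa] := xi n; have [_] := h1 a (xB _ xa); case E: (rho a) => [//|y l] _.
have ya : y \in rho a by rewrite E mem_head.
by exists y; [exact: leq_trans (h3 _ _ (xB _ xa) ya)|exists a].
Qed.

Lemma spreadU1 rho a x : spread rho (a |` x) = [set` rho a] `|` spread rho x.
Proof. by rewrite /spread bigcup_setU bigcup_set1. Qed.

(** Reading one element of [x] reveals a whole nonempty block of [spread rho x],
    so the blocks are read no later than the elements. *)
Lemma ranked_spread t P A B rho : spreading rho A B -> ranked t P A ->
  ranked t (fun N x => P N (spread rho x)) B.
Proof.
elim: t P A B => [|f IH] P A B rB.
  move=> [N PN]; exists N => x xB xi; apply: PN; first exact: spread_sub xB.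
  exact: spread_infinite rB xB xi.
move=> h a Ba; have [h1 h2 h3 h4] := rB; have [] := h1 a Ba.
case E: (rho a) => [//|y l] sl _; have Ay : A y by apply: (h2 a) => //; rewrite /= E mem_head.
have [b hb] := h y Ay; exists b.
pose A' := A `&` [set z | forall u, u \in rho a -> u < z].
have hA' : ranked (f b) (fun N x => P N (y |` ([set` l] `|` x))) A'.
  apply: (ranked_stem (A := A `\` `I_y.+1)) hb; first exact: path_sorted sl.
  - move=> z zl; split; first by apply: (h2 a) => //; rewrite /= E inE zl orbT.
    move: sl; rewrite /= (path_sortedE ltn_trans) => /andP[/allP/(_ _ zl) yz _].
    by rewrite /= ltnS leqNgt (yz : y < z).
  - move=> z [Az /(_ y)]; rewrite E mem_head => /(_ isT) yz; split=> //=; lia.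
  - by move=> u z ul [_]; apply; rewrite E inE ul orbT.
have sub : B `\` `I_a.+1 `<=` B by move=> z [].
have rA' : spreading rho A' (B `\` `I_a.+1).
  have [k1 k2 k3 k4] := spreading_sub sub rB; split=> //.
  move=> c [Bc /= ac] z zc; split; first exact: (h2 c).
  move=> u ua; apply: leq_trans (h3 _ _ Bc zc); apply: h4 ua => //; lia.
apply: ranked_mono (IH _ _ _ _ rA' hA') => // N x _ _; congr P.
rewrite spreadU1 setUA; congr (_ `|` _); apply/seteqP; split=> z /=.
  by move=> [->|zl]; rewrite E ?mem_head// inE zl orbT.
by rewrite E inE => /orP[/eqP->|zl]; [left|right].
Qed.

(** * Increasing enumerations *)

Definition cons_fun (a : nat) (e : nat -> nat) k := if k is k'.+1 then e k' else a.

Lemma cons_incr a e : (forall k, a < e k) -> {homo e : i j / i < j} ->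
  {homo cons_fun a e : i j / i < j}.
Proof. by move=> ae ei [|i] [|j] //= ij; exact: ei. Qed.

Lemma range_cons a e : range (cons_fun a e) = a |` range e.
Proof.
apply/seteqP; split=> [_ [[|k] _ <-]|_ [->|[k _ <-]]].
- by left.
- by right; exists k.
- by exists 0.
- by exists k.+1.
Qed.

Definition interleave (u w : nat -> nat) k := if odd k then w k./2 else u k./2.

Lemma interleave_even u w k : interleave u w k.*2 = u k.
Proof. by rewrite /interleave odd_double doubleK. Qed.

Lemma interleave_odd u w k : interleave u w k.*2.+1 = w k.
Proof. by rewrite /interleave /= odd_double /= uphalf_double. Qed.

Lemma interleave_incr u w : (forall k, u k < w k) -> (forall k, w k < u k.+1) ->
  {homo interleave u w : i j / i < j}.
Proof.
move=> uw wu; apply: homo_ltn => [? ? ?|k]; first exact: ltn_trans.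
rewrite /interleave /= uphalf_half; case: (odd k) => /=; first by rewrite add1n.
by rewrite add0n.
Qed.

Lemma range_interleave u w : range (interleave u w) = range u `|` range w.
Proof.
apply/seteqP; split=> [_ [k _ <-]|_ [[k _ <-]|[k _ <-]]].
- by rewrite /interleave; case: odd; [right|left]; exists k./2.
- by exists k.*2 => //; exact: interleave_even.
- by exists k.*2.+1 => //; exact: interleave_odd.
Qed.

Lemma range_cons_odd a b e : range (fun k => cons_fun a (cons_fun b e) k.*2.+1) =
  b |` range (fun k => e k.*2.+1).
Proof.
by rewrite -range_cons; congr (image setT); apply/funext => -[|k].
Qed.

Lemma enumerated (x : set nat) : infinite_set x ->
  exists2 e, {homo e : i j / i < j} & range e = x.
Proof.
move=> xi.
have xi' : (fun n => `[< x n >]) \in infinite_subsets.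
  by apply/mem_set; rewrite /infinite_subsets /= (_ : [set n | _] = x)//;
     apply/seteqP; split=> n /asboolP.
pose x' : infN := exist _ (fun n => `[< x n >]) xi'.
exists (enumeration x'); first exact: enumeration_lt.
by rewrite range_enumeration; apply/seteqP; split=> n /asboolP.
Qed.

Lemma lt_first a e : {homo e : i j / i < j} -> a < e 0 -> forall k, a < e k.
Proof. by move=> ei ae [//|k]; exact: ltn_trans ae (ei _ _ _). Qed.

Lemma cons_below a e : (forall k, a < e k) -> {homo e : i j / i < j} ->
  {homo cons_fun a e : i j / i < j} /\
  forall b, b < a -> forall k, b < cons_fun a e k.
Proof.
move=> ae ei; split; first exact: cons_incr.
by move=> b ba [//|k] /=; exact: ltn_trans ba (ae k).
Qed.

(** * Relations that absorb the shift *)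

(** The relations are on all sets of natural numbers so that stems can be added by
    unions. *)
Definition filtration (R : nat -> set nat -> set nat -> Prop) :=
  (forall n, RelationClasses.Equivalence (R n)) /\
  (forall m n x y, m <= n -> R m x y -> R n x y).

Definition links (R : nat -> set nat -> set nat -> Prop) N x :=
  forall e, {homo e : i j / i < j} -> range e = x ->
  R N x (range (fun k => e k.+1)) /\ R N x (range (fun k => e k.*2.+1)).

Lemma links_cost R : filtration R -> cost_pred (links R).
Proof. by move=> [_ Rm] M N x MN h e ei ex; have [] := h e ei ex; split; exact: Rm MN _. Qed.

(** All four sets start with at least two elements of [p], [q], [r]. This is what
    makes the rank drop by two. *)
Definition stem_links R p q r N x := [/\ links R N (p |` (q |` (r |` x))),
  links R N (q |` (r |` x)), links R N (p |` (r |` x)) & links R N (p |` (q |` x))].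

Section relink.
Variables (R : nat -> set nat -> set nat -> Prop) (p q r : nat) (N : nat).
Hypotheses (RF : filtration R) (pq : p < q) (qr : q < r).

Let RN := RF.1 N.

(** With [x] the interleaving of [u] and [w], [S1] maps [p, q, r, x] to [q, u] and
    [p, r, x] to [r, w]; dropping first elements links all of these through
    [r, x]. *)
Lemma link_interleave u w : (forall k, u k < w k) -> (forall k, w k < u k.+1) ->
  r < u 0 -> stem_links R p q r N (range u `|` range w) ->
  R N (q |` range u) (r |` range w).
Proof.
move=> uw wu ru; rewrite -range_interleave.
have xi := interleave_incr uw wu; have rx := lt_first xi ru.
set x := interleave u w in xi rx *.
have [ri rP] := cons_below rx xi; have [qi qP] := cons_below (rP _ qr) ri.
have [pi' _] := cons_below (rP _ (ltn_trans pq qr)) ri.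
have [pi _] := cons_below (qP _ pq) qi.
move=> [l1 l2 l3 _].
have [|h1 h2] := l1 _ pi; first by rewrite !range_cons.
have [|h3 _] := l2 _ qi; first by rewrite !range_cons.
have [|h4 h5] := l3 _ pi'; first by rewrite !range_cons.
have xE : (fun k => x k.*2) = u by apply/funext => k; exact: interleave_even.
have xO : (fun k => x k.*2.+1) = w by apply/funext => k; exact: interleave_odd.
rewrite !range_cons_odd /= ?xE ?xO in h2 h5.
have {}h1 : R N (p |` (q |` (r |` range x))) (q |` (r |` range x)).
  by move: h1; rewrite -2!range_cons.
have {}h3 : R N (q |` (r |` range x)) (r |` range x) by move: h3; rewrite -range_cons.
have {}h4 : R N (p |` (r |` range x)) (r |` range x) by move: h4; rewrite -range_cons.
have [Rr Rs Rt] := RN.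
apply: (Rt _ _ _ (Rs _ _ h2)); apply: (Rt _ _ _ h1); apply: (Rt _ _ _ h3).
exact: (Rt _ _ _ (Rs _ _ h4)).
Qed.

(** The path is [q, c], [r, v3], [q, v2], [r, v1'], [q, c'], where [v1'] and [c']
    are [v1] and [c] without their first element. Consecutive sets interleave, so
    [link_interleave] applies four times. A path of length two does not exist,
    since [c] and [c'] cannot both interleave with a common odd part. The last
    conclusion only needs [S1] on [p, q, c]. *)
Lemma links_of_stem_links c v1 v2 v3 :
  (forall k, [/\ c k < v1 k, v1 k < v2 k, v2 k < v3 k & v3 k < c k.+1]) ->
  r < c 0 ->
  stem_links R p q r N (range c `|` range v3) ->
  stem_links R p q r N (range v2 `|` range v3) ->
  stem_links R p q r N (range v2 `|` range (fun k => v1 k.+1)) ->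
  stem_links R p q r N (range (fun k => c k.+1) `|` range (fun k => v1 k.+1)) ->
  stem_links R p q r N (range c) ->
  R N (q |` range c) (q |` range (fun k => c k.+1)) /\
  R N (q |` range c) (q |` range (fun k => c k.*2.+1)).
Proof.
move=> cv rc.
have cvs k : c k < v1 k < v2 k /\ v2 k < v3 k < c k.+1.
  by have [-> -> -> ->] := cv k.
have ci : {homo c : i j / i < j}.
  by apply: homo_ltn => [? ? ?|k]; [exact: ltn_trans|have := cvs k; lia].
move=> /link_interleave l1 /link_interleave l2 /link_interleave l3 /link_interleave l4 l5.
have [Rr Rs Rt] := RN; split.
  apply: (Rt _ (r |` range v3)).
    by apply: l1 => // k; have := cvs k; lia.
  apply: (Rt _ (q |` range v2)); first apply: (Rs).
    by apply: l2 => [k|k|]; [have := cvs k; have := cvs k.+1|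
      have := cvs k; have := cvs k.+1|have := cvs 0]; lia.
  apply: (Rt _ (r |` range (fun k => v1 k.+1))).
    by apply: l3 => [k|k|]; [have := cvs k; have := cvs k.+1|
      have := cvs k; have := cvs k.+1|have := cvs 0]; lia.
  apply: Rs.
    by apply: l4 => [k|k|]; [have := cvs k.+1|have := cvs k.+1; have := cvs k.+2|
      have := cvs 0; have := cvs 1]; lia.
have rcc := lt_first ci rc.
have [qi qP] := cons_below (fun k => ltn_trans qr (rcc k)) ci.
have [pi _] := cons_below (qP _ pq) qi.
case: l5 => _ _ _ l; have [|h1 h2] := l _ pi; first by rewrite !range_cons.
rewrite range_cons_odd in h2; apply: Rt h2; apply: Rs.
by move: h1; rewrite -range_cons.
Qed.
End relink.

(** [B] is a subset of [A] so sparse that each element is followed by three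
    elements of [A] before the next element of [B]. *)
Record followers (A B : set nat) (v1 v2 v3 : nat -> nat) : Prop := Followers {
  followers_sub : forall a, B a -> [/\ A a, A (v1 a), A (v2 a) & A (v3 a)];
  followers_lt : forall a, B a -> [/\ a < v1 a, v1 a < v2 a & v2 a < v3 a];
  followers_next : forall a b, B a -> B b -> a < b -> v3 a < b }.

Lemma followers_exist A : infinite_set A ->
  exists B v1 v2 v3, infinite_set B /\ followers A B v1 v2 v3.
Proof.
move=> /enumerated[e ei eA].
have mono := leqW_mono (leq_mono ei).
have /choice[idx idxP] : forall a, exists k, A a -> e k = a.
  move=> a; have [|] := pselect (A a); last by exists 0.
  by rewrite -eA => -[k _ ka]; exists k.
have eidx k : idx (e k) = k.
  have ek : A (e k) by rewrite -eA; exists k.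
  have := idxP _ ek; have := mono (idx (e k)) k; have := mono k (idx (e k)).
  by move=> + + E; rewrite E ltnn; lia.
have Ae k : A (e k) by rewrite -eA; exists k.
exists (range (fun k => e (4 * k))); do 3! eexists; last split.
  by apply: infinite_range => i j ij; apply: ei; lia.
apply: (@Followers _ _ (fun a => e (idx a + 1)) (fun a => e (idx a + 2))
  (fun a => e (idx a + 3))).
- by move=> _ [k _ <-].
- by move=> _ [k _ <-]; rewrite !eidx; split; [rewrite -{1}[4 * k]addn0| |]; apply: ei; lia.
- by move=> _ _ [k _ <-] [l _ <-]; rewrite !eidx !mono; lia.
Qed.

Lemma followers_spreading A B v1 v2 v3 rho : followers A B v1 v2 v3 ->
  (forall a, B a -> [/\ sorted ltn (rho a), rho a <> [::] &
    {subset rho a <= [:: a; v1 a; v2 a; v3 a]}]) ->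
  spreading rho A B.
Proof.
move=> [BA Bl Bn] rP; split.
- by move=> a /rP[].
- move=> a Ba y; have [_ _ /(_ y) h] := rP a Ba; move=> /h.
  by have [? ? ? ?] := BA a Ba; rewrite !inE => /or4P[] /eqP->.
- move=> a y Ba; have [_ _ /(_ y) h] := rP a Ba; move=> /h.
  by have [? ? ?] := Bl a Ba; rewrite !inE => /or4P[] /eqP->; lia.
- move=> a b y Ba Bb ab; have [_ _ /(_ y) h] := rP a Ba; move=> /h.
  have [? ? ?] := Bl a Ba; have := Bn a b Ba Bb ab.
  by rewrite !inE => ? /or4P[] /eqP->; lia.
Qed.

Lemma followers_above A B v1 v2 v3 a : followers A B v1 v2 v3 -> B a ->
  followers (A `\` `I_(v2 a).+1) (B `\` `I_a.+1) v1 v2 v3.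
Proof.
move=> [BA Bl Bn] Ba; split=> [b [Bb /= ab]|b [/Bl//]|b c [Bb _] [Bc _]]; last exact: Bn.
have [? ? ? ?] := BA b Bb; have [? ? ?] := Bl b Bb; have [? ? ?] := Bl a Ba.
by have := Bn a b Ba Bb; split; split=> //=; lia.
Qed.

Lemma spread2 f g (e : nat -> nat) : spread (fun a => [:: f a; g a]) (range e) =
  range (fun k => f (e k)) `|` range (fun k => g (e k)).
Proof.
apply/seteqP; split=> [y [_ [k _ <-]]|y [[k _ <-]|[k _ <-]]] /=.
- by rewrite !inE => /orP[]/eqP->; [left|right]; exists k.
- by exists (e k); [exists k|rewrite /= mem_head].
- by exists (e k); [exists k|rewrite /= !inE eqxx orbT].
Qed.

Lemma followers_pairs A B v1 v2 v3 : followers A B v1 v2 v3 ->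
  [/\ spreading (fun a => [:: a; v3 a]) A B, spreading (fun a => [:: v2 a; v3 a]) A B,
      spreading (fun a => [:: v1 a; v2 a]) A B & spreading (fun a => [:: a; v1 a]) A B].
Proof.
move=> BF; split; apply: (followers_spreading BF) => b Bb;
  have [? ? ?] := followers_lt BF Bb; (split=> //; first by rewrite /= andbT; lia);
  by move=> y; rewrite !inE => /orP[]/eqP->; rewrite eqxx ?orbT.
Qed.

Lemma cost_pred_and P Q : cost_pred P -> cost_pred Q -> cost_pred (fun N x => P N x /\ Q N x).
Proof. by move=> hP hQ M N x MN [? ?]; split; [exact: hP MN _|exact: hQ MN _]. Qed.

Section shifted_relation.
Variables (R : nat -> set nat -> set nat -> Prop) (A B : set nat) (p q r : nat).
Variables (v1 v2 v3 : nat -> nat).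
Hypotheses (RF : filtration R) (pq : p < q) (qr : q < r) (rA : forall a, A a -> r < a).
Hypotheses (BF : followers A B v1 v2 v3).

Let S n x y := R n (q |` x) (q |` y).

Lemma stem_links_cost : cost_pred (stem_links R p q r).
Proof. by move=> M N x MN [? ? ? ?]; split; exact: links_cost MN _. Qed.

Let links_shift N e : {homo e : i j / i < j} -> range e `<=` B ->
  stem_links R p q r N (spread (fun a => [:: a; v3 a]) (range e)) ->
  stem_links R p q r N (spread (fun a => [:: v2 a; v3 a]) (range e)) ->
  stem_links R p q r N (v2 (e 0) |` spread (fun a => [:: v1 a; v2 a]) (range (fun k => e k.+1))) ->
  stem_links R p q r N (spread (fun a => [:: a; v1 a]) (range (fun k => e k.+1))) ->
  stem_links R p q r N (range e) ->
  links S N (range e).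
Proof.
move=> ei eB; rewrite !spread2 => h1 h2 h3 h4 h5 e' e'i e'e.
have {e'i e'e} -> : e' = e by apply/funext; exact: homo_range_inj.
have Be k : B (e k) by apply: eB; exists k.
have [BA Bl Bn] := BF.
apply: (links_of_stem_links (N := N) RF pq qr (c := e) (v1 := v1 \o e) (v2 := v2 \o e) (v3 := v3 \o e)) => //.
- by move=> k; have [? ? ?] := Bl _ (Be k); split=> //; apply: Bn => //; exact: ei.
- by apply: rA; have [] := BA _ (Be 0).
- move: h3; rewrite setUA setUAC -range_cons [X in range X `|` _](_ : _ = v2 \o e)//.
  by apply/funext => -[].
Qed.

(** The path ends at [S0 c], so its last sets start only from the second element
    of [c]: this costs one extra level. Once the first element is read, each
    intermediate set is a fixed finite set together with a spread of the rest. *)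
Lemma ranked_shift t : ranked t (stem_links R p q r) A ->
  ranked (Node (fun=> t)) (links S) B.
Proof.
move=> hA a Ba; exists 0; have [BA _ _] := BF; have [Aa _ Av2 _] := BA _ Ba.
have [id3 b23 _ _] := followers_pairs BF.
have [_ _ b12 id1] := followers_pairs (followers_above BF Ba).
have subA : A `\` `I_(v2 a).+1 `<=` A by move=> y [].
have h1 := ranked_cons Ba (ranked_spread id3 hA).
have h2 := ranked_cons Ba (ranked_spread b23 hA).
have h3 := ranked_spread b12 (ranked_cons Av2 hA).
have h4 := ranked_spread id1 (ranked_sub subA hA).
have h5 : ranked t (fun N x => stem_links R p q r N (a |` x)) (B `\` `I_a.+1).
  apply: ranked_sub (ranked_cons Aa hA) => y [By /= ay]; split=> //.
  by have [] := BA _ By.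
have i1 : cost_pred (fun N x => stem_links R p q r N (spread (fun a => [:: a; v3 a]) (a |` x))).
  by move=> M N x; exact: stem_links_cost.
have i2 : cost_pred (fun N x => stem_links R p q r N (spread (fun a => [:: v2 a; v3 a]) (a |` x))).
  by move=> M N x; exact: stem_links_cost.
have i3 : cost_pred (fun N x => stem_links R p q r N (v2 a |` spread (fun a => [:: v1 a; v2 a]) x)).
  by move=> M N x; exact: stem_links_cost.
have i4 : cost_pred (fun N x => stem_links R p q r N (spread (fun a => [:: a; v1 a]) x)).
  by move=> M N x; exact: stem_links_cost.
have i5 : cost_pred (fun N x => stem_links R p q r N (a |` x)).
  by move=> M N x; exact: stem_links_cost.
have := ranked_and i1 (cost_pred_and i2 (cost_pred_and i3 (cost_pred_and i4 i5))) h1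
  (ranked_and i2 (cost_pred_and i3 (cost_pred_and i4 i5)) h2
  (ranked_and i3 (cost_pred_and i4 i5) h3 (ranked_and i4 i5 h4 h5))).
apply: ranked_mono => // N x xB xi [k1 [k2 [k3 [k4 k5]]]].
have [c ci cx] := enumerated xi.
have ac k : a < c k by have /xB[_ /=] : x (c k) by [rewrite -cx; exists k]; lia.
move: k1 k2 k3 k4 k5; rewrite -cx -range_cons => k1 k2 k3 k4 k5.
apply: links_shift => //; first exact: cons_incr.
by rewrite range_cons cx => y [->//|/xB[]].
Qed.

Lemma bounded_shift : ranked Leaf (stem_links R p q r) A -> ranked Leaf (links S) B.
Proof.
move=> [N hN]; exists N => x xB xi; have [c ci cx] := enumerated xi.
have [id3 b23 b12 id1] := followers_pairs BF.
have BA y : B y -> A y by case: BF => h _ _ /h[].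
have Bc k : B (c k) by apply: xB; rewrite -cx; exists k.
have ci' : {homo (fun k => c k.+1) : i j / i < j} by move=> i j ij; exact: ci.
have tailB : range (fun k => c k.+1) `<=` B by move=> _ [k _ <-].
rewrite -cx in xB xi *; apply: links_shift => //; apply: hN.
- exact: spread_sub id3 xB.
- exact: spread_infinite id3 xB xi.
- exact: spread_sub b23 xB.
- exact: spread_infinite b23 xB xi.
- move=> y [->|]; last exact: (spread_sub b12 tailB).
  by case: BF => h _ _; have [] := h _ (Bc 0).
- apply: sub_infinite_set (spread_infinite b12 tailB (infinite_range ci')).
  by move=> y; right.
- exact: spread_sub id1 tailB.
- exact: spread_infinite id1 tailB (infinite_range ci').
- by move=> y /xB/BA.
- exact: xi.
Qed.
End shifted_relation.

(** The stem [p, q, r] has no larger rank than [p, q], which it extends. *)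
Lemma ranked_stem_links R A t p q r : filtration R -> q < r -> A r ->
  ranked t (fun N x => links R N (p |` (q |` x))) (A `\` `I_q.+1) ->
  ranked t (fun N x => links R N (p |` (r |` x))) (A `\` `I_r.+1) ->
  ranked t (fun N x => links R N (q |` (r |` x))) (A `\` `I_r.+1) ->
  ranked t (stem_links R p q r) (A `\` `I_r.+1).
Proof.
move=> RF qr Ar hpq hpr hqr.
have inc (w : set nat -> set nat) : cost_pred (fun N x => links R N (w x)).
  by move=> M N x; exact: links_cost.
have sub : A `\` `I_r.+1 `<=` A `\` `I_q.+1 by move=> y [Ay /= ry]; split=> //=; lia.
have hpqr : ranked t (fun N x => links R N (p |` (q |` (r |` x)))) (A `\` `I_r.+1).
  have /ranked_cons/(_ hpq) : (A `\` `I_q.+1) r by split=> //=; lia.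
  by apply: ranked_sub => y [Ay ry]; split=> //; exact: sub.
have hpq' := ranked_sub sub hpq.
have := ranked_and (inc (fun x => p |` (q |` (r |` x))))
  (cost_pred_and (inc (fun x => q |` (r |` x))) (cost_pred_and (inc (fun x => p |` (r |` x)))
  (inc (fun x => p |` (q |` x))))) hpqr
  (ranked_and (inc (fun x => q |` (r |` x))) (cost_pred_and (inc (fun x => p |` (r |` x)))
  (inc (fun x => p |` (q |` x)))) hqr
  (ranked_and (inc (fun x => p |` (r |` x))) (inc (fun x => p |` (q |` x))) hpr hpq')).
by apply: ranked_mono => // N x _ _ [? [? [? ?]]]; split.
Qed.

(** Induction on the rank, translating by one more element of the stem [s] at each
    step. If the first two levels of the tree are [Node f] and [Node g], stems of
    length two have a rank [g m], and [ranked_shift] yields [Node (fun=> g m)],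
    which is no taller than [Node g], a child of the original tree. *)
Theorem descent t R A : filtration R -> infinite_set A -> ranked t (links R) A ->
  exists s B N, [/\ sorted ltn s, [set` s] `<=` A, B `<=` A, infinite_set B &
    (forall y z, y \in s -> B z -> y < z) /\
    forall e, {homo e : i j / i < j} -> range e `<=` B ->
      R N ([set` s] `|` range e) ([set` s] `|` range (fun k => e k.+1))].
Proof.
elim: t R A => [|f IH] R A RF Ai.
  move=> [N hN]; exists [::], A, N; split=> //; split=> // e ei eA.
  rewrite (_ : [set` [::]] = set0) ?set0U; last by apply/seteqP; split=> x.
  by have [] := hN _ eA (infinite_range ei) e ei erefl.
move=> h; have [p Ap] := infinite_setN0 Ai.
have [q [Aq /= pq]] := infinite_setN0 (@infinite_setDI A p.+1 Ai).
have [r [Ar /= qr]] := infinite_setN0 (@infinite_setDI A q.+1 Ai).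
have {}pq : p < q by lia.
have {}qr : q < r by lia.
have [i hp] := h p Ap; have [j hq] := h q Aq.
have [k [/ranked_le/(_ hp) {}hp /ranked_le/(_ hq) {}hq]] := tree_le_join f i j.
pose A1 := A `\` `I_r.+1; have A1i : infinite_set A1 by exact: infinite_setDI.
have A1A : A1 `<=` A by exact: subDsetl.
have rA1 a : A1 a -> r < a by move=> [_ /=]; lia.
have [B [v1 [v2 [v3 [Bi BF]]]]] := followers_exist A1i.
have BA1 : B `<=` A1 by case: BF => + _ _ a => /(_ a) BA /BA[].
pose S n x y := R n (q |` x) (q |` y).
have SF : filtration S.
  case: RF => Req Rm; split=> [n|m n x y mn]; last exact: Rm.
  have [Rr Rs Rt] := Req n; split=> [x|x y|x y z]; [exact: Rr|exact: Rs|exact: Rt].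
have SB : ranked (f k) (links S) B.
  have sub a b : a < b -> A `\` `I_b.+1 `<=` A `\` `I_a.+1 `\` `I_b.+1.
    by move=> ab y [Ay /= yb]; split=> //; split=> //=; lia.
  have above a b : a < b -> A b -> (A `\` `I_a.+1) b by move=> ab Ab; split=> //=; lia.
  have pr := ltn_trans pq qr.
  case: (f k) hp hq => [hp hq|g hp hq].
    apply: (@bounded_shift R A1 B p q r v1 v2 v3) => //; apply: ranked_stem_links => //.
    - exact: ranked_sub (sub _ _ pq) (ranked_cons (above _ _ pq Aq) hp).
    - exact: ranked_sub (sub _ _ pr) (ranked_cons (above _ _ pr Ar) hp).
    - exact: ranked_sub (sub _ _ qr) (ranked_cons (above _ _ qr Ar) hq).
  have [a1 h1] := hp q (above _ _ pq Aq); have [a2 h2] := hp r (above _ _ pr Ar).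
  have [a3 h3] := hq r (above _ _ qr Ar).
  have [a12 [/ranked_le/(_ h1) {}h1 /ranked_le/(_ h2) {}h2]] := tree_le_join g a1 a2.
  have [m [le12 /ranked_le/(_ h3) {}h3]] := tree_le_join g a12 a3.
  have {}h1 := ranked_sub (sub _ _ pq) (ranked_le le12 h1).
  have {}h2 := ranked_sub (sub _ _ pr) (ranked_le le12 h2).
  have {}h3 := ranked_sub (sub _ _ qr) h3.
  have := ranked_shift RF pq qr rA1 BF (ranked_stem_links RF qr Ar h1 h2 h3).
  by apply: ranked_le => a; exists m; exact: tree_le_refl.
have [s [C [N [ss sB CB Ci [sC RN]]]]] := IH k S B SF Bi SB.
have qB y : B y -> q < y by move=> /BA1/rA1; exact: ltn_trans.
exists (q :: s), C, N; split=> //.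
- by rewrite /= (path_sortedE ltn_trans) ss andbT; apply/allP => y /sB/qB.
- by move=> y /=; rewrite inE => /orP[/eqP->//|/sB/BA1/A1A].
- by apply: subset_trans CB (subset_trans BA1 A1A).
split=> [y z|e ei eC].
  by rewrite inE => /orP[/eqP-> /CB/qB//|]; exact: sC.
have := RN e ei eC; rewrite /S !setUA.
by rewrite (_ : [set` q :: s] = q |` [set` s])// ; apply/seteqP; split=> y /=;
  rewrite inE => /predU1P.
Qed.

(** * Continuous costs have a rank *)

Section bar.
Variables (G : nat -> set (set nat)) (B : set nat).
Hypothesis G_decided : forall b, B b -> forall t i, t `<=` `I_b.+1 -> i <= b ->
  decided (G i) t (B `\` `I_b.+1).
Hypothesis G_cover : forall x, infinite_set x -> exists N, G N x.

(** A pair consists of the elements read so far and of the least number that may be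
    read next. *)
Let good (p : set nat * nat) :=
  exists t, ranked t (fun N x => G N (p.1 `|` x)) (B `\` `I_p.2).

Let good_step (p : set nat * nat) :
  (forall a, B a -> p.2 <= a -> good (a |` p.1, a.+1)) -> good p.
Proof.
case: p => u n /= h.
have /choice[t tP] : forall a, exists t, B a -> n <= a ->
    ranked t (fun N x => G N ((a |` u) `|` x)) (B `\` `I_a.+1).
  move=> a; have [[Ba na]|no] := pselect (B a /\ n <= a).
    by have [t] := h a Ba na; exists t.
  by exists Leaf => Ba na; case: no.
exists (Node t) => a [Ba /= na]; exists a.
have {}na : n <= a by lia.
apply: ranked_mono (tP a Ba na) => [y [[By _] ?] //|N x _ _].
by rewrite /= setUAC [_ `|` u]setUC setUA.
Qed.

(** Bar induction: otherwise one could keep reading elements without the cost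
    getting a rank, producing an infinite set whose cost is decided by no initial
    segment. *)
Lemma bar_ranked : exists t, ranked t G B.
Proof.
suff [t] : good (set0, 0).
  exists t; apply: ranked_mono p => [y By|N x _ _]; last by rewrite /= set0U.
  by split.
apply: contrapT => bad0.
have /choice[nx nxP] : forall p, exists a, ~ good p ->
    [/\ B a, p.2 <= a & ~ good (a |` p.1, a.+1)].
  move=> p; have [gp|bp] := pselect (good p); first by exists 0.
  have : ~ forall a, B a -> p.2 <= a -> good (a |` p.1, a.+1) by move=> /good_step.
  by move=> /existsNP[a /not_implyP[Ba /not_implyP[pa ba]]]; exists a.
pose st k := iter k (fun p => (nx p |` p.1, (nx p).+1)) (set0, 0).
have bad k : ~ good (st k) by elim: k => // k /nxP[].
pose a k := nx (st k).
have aP k : [/\ B (a k), (st k).2 <= a k & st k.+1 = (a k |` (st k).1, (a k).+1)].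
  by have [] := nxP _ (bad k).
have ai : {homo a : i j / i < j}.
  apply: homo_ltn => [? ? ?|k]; first exact: ltn_trans.
  by have [_ _ e] := aP k; have [_ + _] := aP k.+1; rewrite e.
have stE k : (st k).1 = [set a i | i in `I_k].
  elim: k => [|k IH]; first by rewrite II0 image_set0.
  have [_ _ ->] := aP k; rewrite /= IH; apply/seteqP; split.
    move=> _ [->|[i ik <-]]; first by exists k => /=.
    by exists i => //=; move: ik => /=; lia.
  move=> _ [i /= ik <-]; move: ik; rewrite ltnS leq_eqVlt => /orP[/eqP->|ik].
    by left.
  by right; exists i.
have [N GN] := G_cover (infinite_range ai).
have Na : N <= a N by exact: ge_id_homo.
have [BaN _ stN] := aP N.
have sub : (st N.+1).1 `<=` `I_(a N).+1.
  by rewrite stE => _ [i /= iN <-]; rewrite ltnS (leq_mono ai).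
have xc : cube (st N.+1).1 (B `\` `I_(a N).+1) (range a).
  split; first exact: infinite_range.
    by rewrite stE => _ [i _ <-]; exists i.
  move=> _ [i _ <-]; have [iN|Ni] := leqP i N.
    by left; rewrite stE; exists i.
  right; split; first by have [] := aP i.
  by have := ai _ _ Ni; rewrite /=; lia.
have [dG|dG] := G_decided BaN sub Na; last by have := dG _ xc.
apply: (bad N.+1); exists Leaf, N => x xB xi; apply: dG.
split; [by apply: sub_infinite_set xi => y; right|by move=> y; left|].
move=> y [sy|xy]; first by left.
by right; have := xB y xy; rewrite stN.
Qed.
End bar.

Lemma ramsey_ranked (G : nat -> set (set nat)) : (forall N, ramsey (G N)) ->
  (forall x, infinite_set x -> exists N, G N x) ->
  exists A t, infinite_set A /\ ranked t G A.
Proof.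
move=> GR Gx; have [B [_ Bi hB]] := ramsey_fusion GR (@finite_set0 _) infinite_nat.
exists B; have [|t tB] := @bar_ranked G B _ Gx; last by exists t.
by move=> b Bb t i tb ib; have := hB b Bb t i tb ib; rewrite set0U.
Qed.

(** Each coordinate of [psi] is decided on the sets whose elements after [s] are
    large enough, and by invariance every set can be brought to that form by
    dropping elements. *)
Lemma ramsey_tail_constant (psi : set nat -> nat -> bool) (s A : set nat) :
  (forall i, ramsey [set x | psi x i]) -> finite_set s -> infinite_set A ->
  (forall e, {homo e : i j / i < j} -> range e `<=` A ->
    psi (s `|` range e) = psi (s `|` range (fun k => e k.+1))) ->
  exists B, [/\ B `<=` A, infinite_set B & forall x y, x `<=` B -> y `<=` B ->
    infinite_set x -> infinite_set y -> psi (s `|` x) = psi (s `|` y)].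
Proof.
move=> pR sf Ai inv; have [B [BA Bi hB]] := ramsey_fusion pR sf Ai.
exists B; split=> // x y xB yB xi yi; apply/funext => i.
have /infinite_nat_setP/(_ i)[b ib Bb] := Bi.
have tail z : z `<=` B -> infinite_set z -> exists2 z',
    cube s (B `\` `I_b.+1) z' & psi (s `|` z) = psi z'.
  move=> zB /enumerated[e ei ez]; rewrite -ez in zB *.
  exists (s `|` range (fun k => e (k + b.+1))).
    have ei' : {homo (fun k => e (k + b.+1)) : i j / i < j}.
      by move=> j k jk; apply: ei; lia.
    split; first by apply: (sub_infinite_set _ (infinite_range ei')) => y'; right.
      by move=> y'; left.
    move=> y' [sy|[k _ <-]]; [by left|right]; split; first by apply: zB; exists (k + b.+1).
    by have := ge_id_homo ei (k + b.+1); rewrite /=; lia.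
  elim: b.+1 => [|m ->]; first by rewrite (_ : (fun k => e (k + 0)) = e)//; apply/funext => k; rewrite addn0.
  rewrite inv => [|j k jk|_ [k _ <-]]; [|by apply: ei; lia|by apply/BA/zB; exists (k + m)].
  rewrite (_ : (fun k => e (k.+1 + m)) = (fun k => e (k + m.+1)))//.
  by apply/funext => k; rewrite addSnnS.
have [x' x'c ->] := tail x xB xi; have [y' y'c ->] := tail y yB yi.
have := hB b Bb set0 i (@sub0set _ _) ib; rewrite setU0 => -[] d.
  by rewrite (d _ x'c) (d _ y'c).
have /negP/negbTE -> := d _ x'c; by have /negP/negbTE -> := d _ y'c.
Qed.

(** * Infinite sets as points of the space *)

Lemma to_infN_subproof (A : set nat) : exists x : infN, infinite_set A -> elts x = A.
Proof.
have [/enumerated[e ei <-]|] := pselect (infinite_set A); last by exists point.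
by exists (of_enumeration ei) => _; exact: elts_of_enumeration.
Qed.

Definition to_infN (A : set nat) : infN := projT1 (cid (to_infN_subproof A)).

Lemma to_infNK A : infinite_set A -> elts (to_infN A) = A.
Proof. by rewrite /to_infN; case: cid. Qed.

Lemma enumeration_range e : {homo e : i j / i < j} ->
  enumeration (to_infN (range e)) = e.
Proof.
move=> ei; apply/funext; apply: homo_range_inj => //; first exact: enumeration_lt.
by rewrite range_enumeration to_infNK//; exact: infinite_range.
Qed.

Lemma S0_range e : {homo e : i j / i < j} ->
  S0 (to_infN (range e)) = to_infN (range (fun k => e k.+1)).
Proof.
move=> ei; apply: elts_inj; rewrite elts_of_enumeration enumeration_range// to_infNK//.
by apply: infinite_range => i j ij; exact: ei.
Qed.

Lemma S1_range e : {homo e : i j / i < j} ->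
  S1 (to_infN (range e)) = to_infN (range (fun k => e k.*2.+1)).
Proof.
move=> ei; apply: elts_inj; rewrite elts_of_enumeration enumeration_range// to_infNK//.
by apply: infinite_range => i j ij; apply: ei; lia.
Qed.

(** * Borel sets are Ramsey *)

Definition agree n x y := elts x `&` `I_n = elts y `&` `I_n.

(** A Lipschitz condition, satisfied by the identity, [S0] and [S1]. *)
Definition depends_on_initial (T : infN -> infN) :=
  forall n x y, agree n x y -> agree n (T x) (T y).

Lemma open_agree (U : set infN) x : open U -> U x ->
  exists n, forall y, agree n x y -> U y.
Proof.
move=> [V Vop <-] Vx.
pose F : set_system cantor_space := [set W | exists n, forall c : cantor_space,
  (forall m, m < n -> c m = (\val x : cantor_space) m) -> W c].
have FF : Filter F.
  split; first by exists 0.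
    move=> P Q [m Pm] [n Qn]; exists (maxn m n) => c cx.
    by split; [apply: Pm|apply: Qn] => k kn; apply: cx; lia.
  by move=> P Q PQ [n Pn]; exists n => c /Pn/PQ.
have /pointwise_cvgP Fx : forall t, (fun g : cantor_space => g t) @ F --> (\val x : cantor_space) t.
  move=> t W /nbhs_singleton Wt; exists t.+1 => c cx.
  by rewrite /= cx.
have [n hn] : F V by apply: Fx; exact: open_nbhs_nbhs.
exists n => y xy; apply: hn => m mn.
have : (elts x `&` `I_n) m <-> (elts y `&` `I_n) m by rewrite xy.
by rewrite /elts /= => h; apply/idP/idP => ?; tauto.
Qed.

(** The sets [V] with this property form a sigma-algebra; open sets have it by
    [decide_open], since the Lipschitz condition keeps preimages open. *)
Lemma measurable_ramsey (T : infN -> infN) (V : set (borel infN)) :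
  depends_on_initial T -> measurable V -> ramsey [set x | V (T (to_infN x))].
Proof.
move=> Tn; move: V; apply: (@smallest_sub _ (sigma_algebra setT) _
  [set V | ramsey [set x | V (T (to_infN x))]]).
  split.
  - by move=> s A sf Ai; exists A; split=> //; right=> x _.
  - move=> V /ramseyC; congr ramsey.
    by apply/seteqP; split=> x /=; [split|case].
  - by move=> V VR; have := ramsey_bigcup VR; congr ramsey.
move=> V Vop s A sf Ai; apply: decide_open => // x Vx xA.
have [n hn] := open_agree Vop Vx; exists n => y [yi sy yA]; apply: hn; apply: Tn.
have [xi sx xA'] := xA.
rewrite /agree !to_infNK//; apply/seteqP; split=> m [mx mn]; split=> //.
  by apply: sy; right.
by have [[/sx//|[]//]|[_ /(_ mn)]] := yA m mx.
Qed.

Lemma enumeration_agree n x y k : agree n x y -> enumeration x k < n ->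
  enumeration y k = enumeration x k.
Proof.
move=> xy.
have mem m : m < n -> (\val x : cantor_space) m = (\val y : cantor_space) m.
  move=> mn; have : (elts x `&` `I_n) m <-> (elts y `&` `I_n) m by rewrite xy.
  by rewrite /elts /= => h; apply/idP/idP => ?; tauto.
have least p p' (ex : exists m, (p <= m) && (\val x : cantor_space) m)
    (ey : exists m, (p' <= m) && (\val y : cantor_space) m) :
    p = p' -> ex_minn ex < n -> ex_minn ey = ex_minn ex.
  move=> pp'; subst p'; case: ex_minnP => m /andP[pm xm] mP mn.
  case: ex_minnP => l /andP[pl yl] lP; apply/eqP; rewrite eqn_leq.
  have lm : l <= m by apply: lP; rewrite pm -mem.
  by rewrite lm mP// pl mem//; exact: leq_ltn_trans mn.
elim: k => [|k IH] kn; first exact: least.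
apply: least => //; congr _.+1; apply: esym; apply: IH; apply: leq_ltn_trans kn.
exact: (ltnW (enumeration_lt _ (ltnSn k))).
Qed.

Lemma agree_sym n x y : agree n x y -> agree n y x.
Proof. by move=> h; exact: esym. Qed.

Lemma depends_on_initial_subsequence (T : infN -> infN) (sigma : nat -> nat) :
  (forall x, elts (T x) = range (fun k => enumeration x (sigma k))) ->
  depends_on_initial T.
Proof.
move=> Ts n x y xy; rewrite /agree !Ts; apply/seteqP.
split=> [_ [[k _ <-]] /= kn|_ [[k _ <-]] /= kn]; split=> //; exists k => //.
  exact: enumeration_agree xy kn.
exact: enumeration_agree (agree_sym xy) kn.
Qed.

Lemma depends_on_initial_S0 : depends_on_initial S0.
Proof.
by apply: (@depends_on_initial_subsequence _ S) => x; rewrite elts_of_enumeration.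
Qed.

Lemma depends_on_initial_S1 : depends_on_initial S1.
Proof.
apply: (@depends_on_initial_subsequence _ (fun k => k.*2.+1)) => x.
by rewrite elts_of_enumeration.
Qed.

Lemma ramseyI P Q : ramsey P -> ramsey Q -> ramsey (P `&` Q).
Proof.
move=> PR QR; rewrite -[P `&` Q]setCK setCI; apply: ramseyC.
have := @ramsey_bigcup (fun i => if i is 0 then ~` P else ~` Q).
have -> : \bigcup_i (if i is 0 then ~` P else ~` Q) = ~` P `|` ~` Q.
  apply/seteqP; split=> [x [[|i] _ h]|x [h|h]]; [by left|by right| |].
    by exists 0.
  by exists 1.
by apply=> -[|i]; exact: ramseyC.
Qed.

Lemma measurable_coordinate i : measurable ([set c : cantor_space | c i] : set (borel cantor_space)).
Proof.
apply: sub_sigma_algebra; rewrite (_ : [set c : cantor_space | c i] = proj i @^-1` [set true]).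
  apply: open_comp; last exact: discrete_open.
  by move=> c _; exact: proj_continuous.
by apply/seteqP; split=> c.
Qed.

(** Two points of the Cantor space are equal when none of the countably many
    coordinates separates them. *)
Lemma ramsey_equalizer (phi : borel infN -> borel cantor_space) T :
  measurable_fun setT phi -> depends_on_initial T ->
  ramsey [set x | phi (to_infN x) = phi (T (to_infN x))].
Proof.
move=> mphi Tn.
pose V i : set (borel infN) := [set x | (phi x : cantor_space) i].
have mV i : measurable (V i).
  by have := mphi measurableT _ (measurable_coordinate i); rewrite setTI.
have idn : depends_on_initial id by [].
pose P i := [set x | V i (to_infN x)]; pose Q i := [set x | V i (T (to_infN x))].
have PR i : ramsey (P i) by exact: (@measurable_ramsey id (V i) idn (mV i)).
have QR i : ramsey (Q i) by exact: (@measurable_ramsey T (V i) Tn (mV i)).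
have : ramsey (~` \bigcup_i ~` (~` (P i `&` ~` Q i) `&` ~` (Q i `&` ~` P i))).
  apply: ramseyC; apply: ramsey_bigcup => i; apply: ramseyC; apply: ramseyI; apply: ramseyC; apply: ramseyI => //;
    exact: ramseyC.
congr ramsey; rewrite setC_bigcup; apply/seteqP; split=> x /= h.
  apply/funext => i; have := h i I; rewrite setCK /P /Q /V /= => -[h1 h2].
  by apply/idP/idP => ?; apply: contrapT => ?; [apply: h1|apply: h2].
by move=> i _; rewrite setCK /P /Q /V /= h; tauto.
Qed.

(** * Growth along a component *)

(** The factor is applied to [i.+1] so that [S0], which moves index 0 to index 1,
    is covered. *)
Definition comparable_growth x y :=
  exists K, forall i, enumeration x i <= enumeration y (K * i.+1) /\
                      enumeration y i <= enumeration x (K * i.+1).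

Lemma enumeration_mono x i j : i <= j -> enumeration x i <= enumeration x j.
Proof. by move=> ij; rewrite (leq_mono (@enumeration_lt x)). Qed.

Lemma comparable_growth_equivalence : RelationClasses.Equivalence comparable_growth.
Proof.
split.
- by move=> x; exists 1 => i; split; apply: enumeration_mono; lia.
- by move=> x y [K h]; exists K => i; have [] := h i.
- move=> x y z [K hK] [L hL]; exists (K * L + K + L) => i.
  have [xy _] := hK i; have [_ zy] := hL i; have [yz _] := hL (K * i.+1).
  have [_ yx] := hK (L * i.+1); split.
    by apply: leq_trans xy (leq_trans yz _); apply: enumeration_mono; nia.
  by apply: leq_trans zy (leq_trans yx _); apply: enumeration_mono; nia.
Qed.

Lemma component_growth x y : component x y -> comparable_growth x y.
Proof.
apply: component_smallest; first exact: comparable_growth_equivalence.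
- move=> {}x; exists 2 => i; rewrite !enumerationK; split; apply: enumeration_mono; lia.
- move=> {}x; exists 2 => i; rewrite !enumerationK; split; apply: enumeration_mono; lia.
Qed.

Lemma component_S0 x : component x (S0 x).
Proof.
by exists [:: S0 x] => //=; rewrite andbT; apply/asboolP; left; left.
Qed.

Lemma component_stem s x : sorted ltn s -> (forall y z, y \in s -> x z -> y < z) ->
  infinite_set x -> component (to_infN ([set` s] `|` x)) (to_infN x).
Proof.
have [Cr Cs Ct] := component_equivalence.
move=> + + xi; elim: s => [|a s IH] ss sx.
  by rewrite (_ : [set` [::]] = set0) ?set0U//; apply/seteqP; split.
apply: Ct (IH (path_sorted ss) _); last by move=> y z ys; apply: sx; rewrite inE ys orbT.
have axi : infinite_set ([set` s] `|` x) by apply: sub_infinite_set xi => y; right.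
have [e ei ex] := enumerated axi.
have ae k : a < e k.
  have : ([set` s] `|` x) (e k) by rewrite -ex; exists k.
  case=> [es|]; last by apply: sx; exact: mem_head.
  by move: ss; rewrite /= (path_sortedE ltn_trans) => /andP[/allP/(_ _ es)].
have -> : [set` a :: s] `|` x = range (cons_fun a e).
  rewrite range_cons ex setUA; congr (_ `|` _); apply/seteqP; split=> y /=;
    rewrite inE => /predU1P; exact.
by rewrite -ex -(S0_range (cons_incr ae ei)); exact: component_S0.
Qed.

Theorem proposition1p4 : ~ hypersmooth (component : borel infN -> borel infN -> Prop).
Proof.
move=> [F [Fs Fm FE]].
have [Cr Cs Ct] := component_equivalence.
have F_mono m n x y : m <= n -> F m x y -> F n x y.
  by move=> mn Fxy; rewrite -(subnK mn); elim: (n - m) => // k; exact: Fm.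
pose R n (u w : set nat) := F n (to_infN u) (to_infN w).
have RF : filtration R.
  split=> [n|m n u w mn]; last exact: F_mono.
  have [[[Fr Fsy Ft] _] _] := Fs n.
  split=> [u|u w|u w z]; [exact: Fr|exact: Fsy|exact: Ft].
pose G n := [set u | F n (to_infN u) (S0 (to_infN u))] `&`
            [set u | F n (to_infN u) (S1 (to_infN u))].
have GR n : ramsey (G n).
  have [_ [phi mphi phiE]] := Fs n.
  have sets_eq T : [set u | F n (to_infN u) (T (to_infN u))] =
      [set u | phi (to_infN u) = phi (T (to_infN u))].
    by apply/seteqP; split=> u /= /phiE.
  apply: ramseyI; rewrite sets_eq; apply: ramsey_equalizer => //.
    exact: depends_on_initial_S0.
  exact: depends_on_initial_S1.
have [|A [t [Ai tA]]] := ramsey_ranked GR.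
  move=> x _; have [m Fm0] := (FE _ _).1 (component_S0 (to_infN x)).
  have [|n Fn1] := (FE (to_infN x) (S1 (to_infN x))).1.
    by exists [:: S1 (to_infN x)] => //=; rewrite andbT; apply/asboolP; right; left.
  by exists (maxn m n); split; [apply: F_mono Fm0|apply: F_mono Fn1]; lia.
have [|s [B [N [ss sA BA Bi [sB RN]]]]] := @descent t R A RF Ai.
  apply: ranked_mono tA => // n x _ xi [h0 h1] e ei ex; rewrite -ex in h0 h1 *.
  by rewrite /R -(S0_range ei) -(S1_range ei).
have [_ [phi mphi phiE]] := Fs N.
pose psi u i := (phi (to_infN u) : cantor_space) i.
have psiR i : ramsey [set x | psi x i].
  have idn : depends_on_initial id by [].
  apply: (@measurable_ramsey id [set x | (phi x : cantor_space) i] idn).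
  by have := mphi measurableT _ (measurable_coordinate i); rewrite setTI.
have [|e ei eB|C [CB Ci psiC]] := @ramsey_tail_constant psi [set` s] B psiR _ Bi.
- exact: finite_seq.
- by have /phiE := RN e ei eB; rewrite /psi => ->.
have [c ci cC] := enumerated Ci.
(* A subset of [C] whose indices in [C] grow faster than any linear function. *)
have c'i : {homo (fun k => c (k.+1 * k.+1)) : i j / i < j}.
  by move=> i j ij; apply: ci; nia.
have c'C : range (fun k => c (k.+1 * k.+1)) `<=` C.
  by move=> _ [k _ <-]; rewrite -cC; exists (k.+1 * k.+1).
have sub x : x `<=` C -> infinite_set x -> component (to_infN ([set` s] `|` x)) (to_infN x).
  by move=> xC xi; apply: component_stem => // y z ys /xC/CB; exact: sB.
have c'inf := infinite_range c'i.
have CC := @subset_refl _ C.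
have : component (to_infN (range (fun k => c (k.+1 * k.+1)))) (to_infN C).
  apply: (Ct _ _ _ _ (sub _ CC Ci)); apply: (Ct _ _ _ (Cs _ _ (sub _ c'C c'inf))).
  apply/FE; exists N; apply/phiE; apply/funext => i.
  exact: (congr1 (fun f => f i) (psiC _ _ c'C CC c'inf Ci)).
move=> /component_growth[K /(_ K)[+ _]]; rewrite -cC !enumeration_range//.
by rewrite (leq_mono ci); nia.
Qed.
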